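(* Let $R=(r_1,r_2,\ldots,r_n)$ be a vector of nonnegative integers with $r_1\le r_2\le\cdots\le r_n$. Then there exists a Hankel tournament with score vector $R$ if and only if $$r_i+r_{n+1-i}=n-1\quad (i=1,2,\ldots,n)$$ and $$\sum_{i=1}^k r_i\ge\binom{k}{2}\quad (k=1,2,\ldots,n),\ \mbox{ with equality if } k=n.$$
   Context: A tournament of order $n$ is an $n\times n$ $(0,1)$-matrix $T=[t_{ij}]$ with $t_{ii}=0$ for all $i$ and $t_{ij}=1-t_{ji}$ for $i\ne j$; its score vector is the vector of its row sums. A Hankel tournament is a tournament symmetric about the anti-diagonal, i.e. $t_{n+1-j,n+1-i}=t_{ij}$ for all $i,j$. *)

(* Defs.v *)
From mathcomp Require Import all_boot all_order all_algebra.

Set Implicit Arguments.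
Unset Strict Implicit.
Unset Printing Implicit Defensive.

Import Order.TTheory GRing.Theory Num.Theory.
Local Open Scope ring_scope.

Definition zero_one_matrix (n : nat) (T : 'M[int]_n) : Prop :=
  forall i j : 'I_n, T i j = 0 \/ T i j = 1.

Definition tournament (n : nat) (T : 'M[int]_n) : Prop :=
  [/\ zero_one_matrix T,
      forall i : 'I_n, T i i = 0
    & forall i j : 'I_n, i != j -> T i j = 1 - T j i].

(* Indices run over 0, ..., n - 1, so that the reflection i |-> n + 1 - i of
   1, ..., n becomes [rev_ord]. *)
Definition hankel_tournament (n : nat) (T : 'M[int]_n) : Prop :=
  tournament T /\ forall i j : 'I_n, T (rev_ord j) (rev_ord i) = T i j.

Definition score_vector (n : nat) (T : 'M[int]_n) : 'rV[int]_n :=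
  \row_i \sum_j T i j.

(* Main.v *)
Require Import Defs.
From mathcomp Require Import all_boot all_order all_algebra.
From mathcomp Require Import zify ring.

(** Call the map x |-> rev_ord x the mirror.  It reverses all arcs of a Hankel
    tournament, so the scores of x and of its mirror image add up to n - 1, and
    Landau's inequalities hold as in any tournament: a set of k vertices
    spans k(k-1)/2 arcs ([sum_inner_arcs]).

    For the converse, start from the transitive tournament and improve it.  Let
    d be the current score vector minus R.  Both satisfy the mirror condition,
    so d is odd under the mirror, and unless d = 0 there is a vertex i with
    d i > 0.  Call x exposed when its mirror image beats it, and dominating when
    it beats its mirror image; the mirror exchanges the two kinds.  Let S be the
    set of vertices reached from i by directed paths all of whose vertices,
    except perhaps the last, are exposed.

    - A simple path of this kind, ending at u, shares no arc with its mirror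
      image, because exposed vertices are mirrored to dominating ones
      ([mirror_arcs_disjoint]).  Reversing both, together with the arc from u
      to its image when u dominates, gives another Hankel tournament
      ([reroute]).
    - If u is not exposed, this moves one point from i to its mirror image.  If
      u is exposed and d u < 0, it moves one point from i to u and one from
      the image of u to the image of i.  In both cases the sum of the absolute
      values of d decreases ([odd_transfer_decrease]).
    - If S contains no such u, then all vertices of S are exposed, so no arc
      leaves S, and d >= 0 on S.  The scores in S then add up to
      |S|(|S|-1)/2, while the sum of R over S is strictly smaller.  As R is
      nondecreasing, the sum over the first |S| indices is no larger
      ([prefix_sum_min]), which contradicts Landau's inequalities.

    So the process can only stop at a tournament with score vector R. *)

Set Implicit Arguments.
Unset Strict Implicit.

Import Order.TTheory GRing.Theory Num.Theory.
Local Open Scope ring_scope.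

(** * Sums over sets of vertices *)

Lemma sum_inner_arcs {n} (T : 'M[int]_n) (S : {set 'I_n}) :
  tournament T -> \sum_(x in S) \sum_(y in S) T x y = 'C(#|S|, 2)%:Z.
Proof.
move=> [_ Tdiag Tanti].
set t := LHS.
have twice_t : t + t = #|S|%:Z * (#|S|%:Z - 1).
  rewrite {2}/t exchange_big /= -big_split /=.
  rewrite (eq_bigr (fun=> #|S|%:Z - 1)) => [|x xS].
    by rewrite sumr_const -mulr_natl natz.
  rewrite -big_split /= (bigD1 x) //= Tdiag !addr0 add0r.
  rewrite (eq_bigr (fun=> 1)) => [|y /andP[_ yx]]; last by rewrite (Tanti y x yx) addrC subrK.
  rewrite sumr_const (cardsD1 x S) xS natz.
  rewrite (eq_card (B := S :\ x)) => [|y]; last by rewrite !inE andbC.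
  by rewrite PoszD addrC addKr.
have := bin2 #|S|; have := mul_bin_diag #|S| 1; rewrite bin1.
by case: #|S| twice_t => [|k] /=; nia.
Qed.

Lemma card_prefix {n k} : (k <= n)%N -> #|[set i : 'I_n | (i < k)%N]| = k.
Proof.
move=> le_kn; rewrite -sum1_card.
rewrite (eq_bigl (fun i : 'I_n => (i < k)%N)) => [|i]; last by rewrite inE.
by rewrite -(big_ord_widen _ (fun=> 1%N)) // sum1_card card_ord.
Qed.

(** Compare both sums after subtracting from each term the value of [f] at the
    last index of the prefix: the shifted terms are nonpositive exactly where
    the prefix collects them. *)
Lemma prefix_sum_min {n} (f : 'I_n -> int) (S : {set 'I_n}) :
    (forall i j : 'I_n, (i <= j)%N -> f i <= f j) ->
  \sum_(i < n | (i < #|S|)%N) f i <= \sum_(i in S) f i.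
Proof.
move=> f_ndecr.
have [S0|S_gt0] := posnP #|S|.
  by rewrite S0 big_pred0 // (cards0_eq S0) big_set0.
have leSn : (#|S| <= n)%N by rewrite -[leqRHS]card_ord max_card.
have ltSn : (#|S|.-1 < n)%N by lia.
pose t := f (Ordinal ltSn).
have shift (P : pred 'I_n) : #|P| = #|S| ->
    \sum_(i | P i) f i = \sum_(i | P i) (f i - t) + #|S|%:Z * t.
  move=> cardP; rewrite -cardP big_split /= sumr_const mulNrn -[#|P|%:Z]natz mulr_natl.
  by rewrite subrK.
rewrite (shift (fun i : 'I_n => (i < #|S|)%N)); last first.
  by rewrite -[RHS](card_prefix leSn); apply: eq_card => i; rewrite !inE.
rewrite (shift (mem S)) // lerD2r.
rewrite big_mkcond [leRHS]big_mkcond /=.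
apply: ler_sum => i _.
have below : (i < #|S|)%N -> f i <= t.
  by move=> lt_iS; apply: f_ndecr; rewrite -ltnS /= prednK.
have above : (#|S| <= i)%N -> t <= f i.
  by move=> le_Si; apply: f_ndecr; apply: leq_trans (leq_pred _) le_Si.
by case: ltnP => [/below|/above] ?; case: ifP => _ //; lia.
Qed.

(** * Mirror images of arcs *)

Lemma hankel_score_mirror {n} (T : 'M[int]_n) (i : 'I_n) :
  hankel_tournament T ->
  score_vector T 0 i + score_vector T 0 (rev_ord i) = n%:Z - 1.
Proof.
move=> [[_ Tdiag Tanti] Tmir]; rewrite !mxE.
rewrite [X in _ + X](reindex_inj rev_ord_inj) /=.
rewrite -big_split /= (bigD1 i) //= Tmir Tdiag !add0r.
rewrite (eq_bigr (fun=> 1)) => [|j ji]; last by rewrite Tmir (Tanti j i ji) addrC subrK.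
rewrite sumr_const (cardC1 i) card_ord natz.
by case: n i {T Tdiag Tanti Tmir} => [[]|] //= *; lia.
Qed.

Lemma transitive_hankel n :
  hankel_tournament (\matrix_(i < n, j < n) ((i < j)%N : nat)%:Z).
Proof.
split; first split.
- by move=> i j; rewrite mxE; case: ltnP; [right|left].
- by move=> i; rewrite mxE ltnn.
- by move=> i j; rewrite !mxE -val_eqE /=; lia.
- by move=> i j; rewrite !mxE /=; have := ltn_ord i; have := ltn_ord j; lia.
Qed.

(** * Reversing sets of arcs *)

Lemma reverse_arcs {n} (T G : 'M[int]_n) :
    hankel_tournament T ->
    (forall a b, G a b = 0 \/ G a b = 1 /\ T a b = 1) ->
    (forall a b, G (rev_ord b) (rev_ord a) = G a b) ->
  hankel_tournament (T - G + G^T).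
Proof.
move=> [[T01 Tdiag Tanti] Tmir] Gsub Gmir.
split; first split.
- move=> a b; rewrite !mxE.
  have [->|ab] := eqVneq a b; first by rewrite Tdiag; left; ring.
  have := Tanti a b ab; have := T01 a b; have := Gsub a b; have := Gsub b a.
  by case=> [->|[-> ->]]; case=> [->|[-> ->]]; case=> ->; lia.
- by move=> a; rewrite !mxE Tdiag; ring.
- by move=> a b ab; rewrite !mxE (Tanti a b ab); ring.
- by move=> a b; rewrite !mxE Tmir !Gmir.
Qed.

Lemma score_reverse {n} (T G : 'M[int]_n) a :
  score_vector (T - G + G^T) 0 a
  = score_vector T 0 a - (\sum_b G a b - \sum_b G b a).
Proof.
rewrite !mxE -sumrB -sumrB; apply: eq_bigr => b _.
by rewrite !mxE; ring.
Qed.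

(** The sum of the arcs as matrices, not their set: this makes the flow of a
    path telescope, and entries are 0 or 1 only when no arc is repeated. *)
Fixpoint path_mx {n} (x : 'I_n) (p : seq 'I_n) : 'M[int]_n :=
  if p is y :: q then delta_mx x y + path_mx y q else 0.

Lemma sum_row_delta {n} (x y a : 'I_n) :
  \sum_b (delta_mx x y : 'M[int]_n) a b = (a == x)%:R.
Proof.
rewrite (bigD1 y) //= big1 => [|b by_]; rewrite mxE ?eqxx ?andbT ?addr0 //.
by rewrite (negPf by_) andbF.
Qed.

Lemma sum_col_delta {n} (x y a : 'I_n) :
  \sum_b (delta_mx x y : 'M[int]_n) b a = (a == y)%:R.
Proof.
rewrite (bigD1 x) //= big1 => [|b bx]; rewrite mxE ?eqxx ?addr0 //.
by rewrite (negPf bx).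
Qed.

Lemma path_mx_flow {n} (x a : 'I_n) p :
  \sum_b path_mx x p a b - \sum_b path_mx x p b a
  = (a == x)%:R - (a == last x p)%:R.
Proof.
elim: p x => [|y p IHp] x /=.
  by rewrite !big1 ?subrr // => b _; rewrite mxE.
under eq_bigr do rewrite mxE; under [X in _ - X]eq_bigr do rewrite mxE.
rewrite !big_split /= sum_row_delta sum_col_delta.
by rewrite opprD addrACA IHp addrA subrK.
Qed.

(** The last clause says that an arc of the path either is its last arc or is
    followed by another one. *)
Lemma path_mx_arc {n} (e : rel 'I_n) (x : 'I_n) p a b :
    path e x p -> uniq (x :: p) ->
  path_mx x p a b = 0 \/
  [/\ path_mx x p a b = 1, a \in x :: p, e a b
    & b = last x p \/ exists c, e b c].
Proof.
elim: p x a b => [|y p IHp] x a b /=; first by rewrite mxE; left.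
move=> /andP[exy yp] /andP[x_notin p_uniq].
rewrite !mxE.
have [/andP[/eqP-> /eqP->]|_] := boolP ((a == x) && (b == y)).
  have -> : path_mx y p x y = 0.
    case: (IHp y x y yp p_uniq) => [//|[_ x_in _ _]].
    by rewrite x_in in x_notin.
  right; split; rewrite ?inE ?eqxx //.
  by case: p yp {IHp x_notin p_uniq} => [|z p] /=; [left|case/andP; right; exists z].
rewrite add0r; case: (IHp y a b yp p_uniq) => [|[Fab a_in eab next]]; first by left.
by right; split; rewrite // inE a_in orbT.
Qed.

(** * Rerouting points along exposed vertices *)

Lemma arc_asym {n} (T : 'M[int]_n) x y :
  tournament T -> T x y = 1 -> T y x = 1 -> False.
Proof.
move=> [_ Tdiag Tanti] Txy Tyx.
have [xy|xy] := eqVneq x y; first by rewrite xy Tdiag in Txy.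
by have := Tanti x y xy; rewrite Txy Tyx.
Qed.

Lemma arc_total {n} (T : 'M[int]_n) x y :
  tournament T -> x != y -> T x y != 1 -> T y x = 1.
Proof.
move=> [T01 _ Tanti] xy Txy; have := Tanti y x.
rewrite eq_sym xy => ->//.
by case: (T01 x y) Txy => [->|->]; rewrite ?eqxx.
Qed.

Definition exposed {n} (T : 'M[int]_n) : pred 'I_n :=
  fun x => T (rev_ord x) x == 1.

Definition exposed_arc {n} (T : 'M[int]_n) : rel 'I_n :=
  fun x y => exposed T x && (T x y == 1).

Lemma exposed_mirror {n} (T : 'M[int]_n) x :
  tournament T -> exposed T x -> ~~ exposed T (rev_ord x).
Proof.
move=> Ttour /eqP Tx; apply/negP; rewrite /exposed rev_ordK => /eqP.
exact: arc_asym Tx.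
Qed.

(** If both a -> b and its mirror image lie on the path, then a and the image
    of b are exposed, so b and the image of a are not.  Both must then be the
    last vertex, so that a -> b joins a to its own mirror image, whereas a is
    exposed. *)
Lemma mirror_arcs_disjoint {n} (T : 'M[int]_n) (x : 'I_n) p a b :
    tournament T -> path (exposed_arc T) x p -> uniq (x :: p) ->
  path_mx x p a b = 1 -> path_mx x p (rev_ord b) (rev_ord a) = 0.
Proof.
move=> Ttour xp p_uniq Fab.
case: (path_mx_arc (rev_ord b) (rev_ord a) xp p_uniq) => [//|].
case=> _ _ /andP[exp_b' _] next_a'.
case: (path_mx_arc a b xp p_uniq) => [|]; first by rewrite Fab.
case=> _ _ /andP[exp_a /eqP Tab] next_b.
have nexp_a' := exposed_mirror Ttour exp_a.
have nexp_b := exposed_mirror Ttour exp_b'; rewrite rev_ordK in nexp_b.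
case: next_b => [b_last|[c /andP[exp_b _]]]; last by rewrite exp_b in nexp_b.
case: next_a' => [a'_last|[c /andP[exp_a' _]]]; last by rewrite exp_a' in nexp_a'.
case: (arc_asym Ttour Tab); rewrite b_last -a'_last.
exact/eqP.
Qed.

(** The union of the path, its mirror image and possibly the middle arc from u
    to the mirror image of u is closed under the mirror, so reversing it keeps
    the Hankel property.  When the middle arc belongs to it, or u is its own
    mirror image, the union is a trail from x to the mirror image of x;
    otherwise u is exposed and the union consists of two separate paths, whence
    the last term in the new scores. *)
Lemma reroute {n} (T : 'M[int]_n) (x : 'I_n) p (u := last x p) :
    hankel_tournament T -> path (exposed_arc T) x p -> uniq (x :: p) ->
  exists T', hankel_tournament T' /\
    forall a, score_vector T' 0 a = score_vector T 0 a
      - ((a == x)%:R - (a == rev_ord x)%:R)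
      + (exposed T u)%:R * ((a == u)%:R - (a == rev_ord u)%:R).
Proof.
move=> Thankel xp p_uniq; have [Ttour Tmir] := Thankel.
have [T01 Tdiag _] := Ttour.
pose F := path_mx x p.
pose Fmir : 'M[int]_n := \matrix_(a, b) F (rev_ord b) (rev_ord a).
pose M : 'M[int]_n := T u (rev_ord u) *: delta_mx u (rev_ord u).
have F_arc a b : F a b = 0 \/ [/\ F a b = 1, T a b = 1 & exposed T a].
  case: (path_mx_arc a b xp p_uniq) => [|[Fab _ /andP[exp_a /eqP Tab] _]].
    by left.
  by right.
have M_arc a b : M a b = 0 \/ [/\ M a b = 1, a = u, b = rev_ord u & T a b = 1].
  rewrite !mxE; have [->|_] := eqVneq a u; last by left; rewrite mulr0.
  have [->|_] := eqVneq b (rev_ord u); last by left; rewrite mulr0.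
  rewrite mulr1.
  by case: (T01 u (rev_ord u)) => Tu; [left|right; split; rewrite // Tu].
exists (T - (F + Fmir + M) + (F + Fmir + M)^T); split.
  apply: reverse_arcs => // a b; last first.
    rewrite !mxE !rev_ordK [F _ _ + F _ _]addrC.
    by rewrite (can2_eq rev_ordK rev_ordK) (inj_eq rev_ord_inj) [_ && _]andbC.
  have -> : (F + Fmir + M) a b = F a b + F (rev_ord b) (rev_ord a) + M a b.
    by rewrite /Fmir !mxE.
  have off_path c d : M c d = 1 -> F c d = 0.
    case: (M_arc c d) => [->//|[_ -> -> Tu] _].
    case: (F_arc u (rev_ord u)) => [//|[_ _ /eqP Tu']].
    by case: (arc_asym Ttour Tu Tu').
  case: (M_arc a b) => [->|[Mab a_u b_u' Tab]].
    rewrite addr0; case: (F_arc a b) => [->|[Fab Tab _]].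
      rewrite add0r; case: (F_arc (rev_ord b) (rev_ord a)) => [->|[-> Tab _]].
        by left.
      by right; rewrite -Tmir Tab.
    by right; rewrite (mirror_arcs_disjoint Ttour xp p_uniq Fab) Fab addr0.
  right; split=> //; rewrite Mab off_path // add0r.
  have -> : rev_ord b = a by rewrite b_u' rev_ordK a_u.
  have -> : rev_ord a = b by rewrite b_u' a_u.
  by rewrite off_path.
move=> a; rewrite score_reverse.
have flowF : \sum_b F a b - \sum_b F b a = (a == x)%:R - (a == u)%:R.
  exact: path_mx_flow.
have flowFmir : \sum_b Fmir a b - \sum_b Fmir b a
    = (a == rev_ord u)%:R - (a == rev_ord x)%:R.
  rewrite -!(can2_eq rev_ordK rev_ordK) -[RHS]opprB -path_mx_flow opprB.
  congr (_ - _); rewrite [RHS](reindex_inj rev_ord_inj) /=.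
    by apply: eq_bigr => b _; rewrite mxE.
  by apply: eq_bigr => b _; rewrite mxE.
have flowM : \sum_b M a b - \sum_b M b a
    = T u (rev_ord u) * ((a == u)%:R - (a == rev_ord u)%:R).
  rewrite mulrBr -(sum_row_delta u (rev_ord u)) -(sum_col_delta u (rev_ord u)).
  by rewrite !mulr_sumr; congr (_ - _); apply: eq_bigr => b _; rewrite !mxE.
(* A vertex that is its own mirror image is not exposed, and then the last
   factor vanishes. *)
have exposedE : T u (rev_ord u) * ((a == u)%:R - (a == rev_ord u)%:R)
    = (1 - (exposed T u)%:R) * ((a == u)%:R - (a == rev_ord u)%:R).
  have [u_u'|u_u'] := eqVneq u (rev_ord u); first by rewrite -u_u' subrr !mulr0.
  have [Tu'|Tu'] := boolP (exposed T u).
    case: (T01 u (rev_ord u)) => [->|Tu]; first by rewrite subrr.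
    by case: (arc_asym Ttour Tu (eqP Tu')).
  by rewrite (arc_total Ttour _ Tu') 1?eq_sym // subr0.
have -> : \sum_b (F + Fmir + M) a b - \sum_b (F + Fmir + M) b a =
   (\sum_b F a b - \sum_b F b a) + (\sum_b Fmir a b - \sum_b Fmir b a)
   + (\sum_b M a b - \sum_b M b a).
  by rewrite -!sumrB -!big_split; apply: eq_bigr => b _; rewrite !mxE /=; ring.
by rewrite flowF flowFmir flowM exposedE; ring.
Qed.

(** * Descent to the prescribed scores *)

(** At i and at the mirror image of u the value is positive and goes down by
    one; at u and at the mirror image of i it is negative and goes up by one.
    The signs and the condition on u make these four vertices distinct, so that
    no value changes by two and jumps over zero.  The boolean [c] says whether
    the transfer through u takes place. *)
Lemma odd_transfer_decrease {n} (d : 'I_n -> int) (i u : 'I_n) (c : bool) :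
    (forall a, d (rev_ord a) = - d a) -> 0 < d i ->
    (c -> d u < 0 /\ u != rev_ord i) ->
  \sum_a `|d a - ((a == i)%:R - (a == rev_ord i)%:R)
              + c%:R * ((a == u)%:R - (a == rev_ord u)%:R)|
  < \sum_a `|d a|.
Proof.
move=> d_odd di c_u.
have mirror_neq v : d v != 0 -> (v == rev_ord v) = false.
  apply: contraNF => /eqP v_v'; have := d_odd v; rewrite -v_v'.
  by move: (d v) => ?; lia.
have i_i' : (i == rev_ord i) = false by rewrite mirror_neq ?gt_eqF.
have closer a : `|d a - ((a == i)%:R - (a == rev_ord i)%:R)
    + c%:R * ((a == u)%:R - (a == rev_ord u)%:R)| <= `|d a| - (a == i)%:R.
  case: c c_u => [[]// du u_i'|_]; last first.
    rewrite mul0r addr0; have [->|_] := eqVneq a i.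
      by rewrite i_i' /=; move: (d i) di => ? ?; lia.
    have [->|_] := eqVneq a (rev_ord i); last by rewrite /=; move: (d a) => ?; lia.
    by rewrite d_odd /=; move: (d i) di => ? ?; lia.
  have u_u' : (u == rev_ord u) = false by rewrite mirror_neq ?lt_eqF.
  have u_i : (u == i) = false by apply: contraTF du => /eqP->; rewrite -leNgt ltW.
  have i_u' : (i == rev_ord u) = false.
    by apply: contraNF u_i' => /eqP->; rewrite rev_ordK.
  rewrite mul1r; have [->|a_i] := eqVneq a i.
    by rewrite i_i' (eq_sym i u) u_i i_u' /=; move: (d i) di => ? ?; lia.
  have [->|a_i'] := eqVneq a (rev_ord i).
    rewrite (inj_eq rev_ord_inj) (eq_sym i u) u_i (eq_sym _ u) (negPf u_i') d_odd /=.
    by move: (d i) di => ? ?; lia.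
  have [->|a_u] := eqVneq a u; first by rewrite u_u' /=; move: (d u) du => ? ?; lia.
  have [->|a_u'] := eqVneq a (rev_ord u); last by rewrite /=; move: (d a) => ?; lia.
  by rewrite d_odd /=; move: (d u) du => ? ?; lia.
apply: le_lt_trans (ler_sum _ (fun a _ => closer a)) _.
rewrite sumrB ltrBlDr ltrDl (bigD1 i) //= eqxx big1 ?addr0 // => a.
by move/negPf->.
Qed.

(** One step of the descent: either some vertex [u] reached from a vertex [i]
    of positive deviation allows a rerouting, or the vertices reached from [i]
    violate Landau's inequality. *)
Lemma deviation_decrease {n} (T : 'M[int]_n) (R : 'rV[int]_n) :
    hankel_tournament T ->
    (forall i, R 0 i + R 0 (rev_ord i) = n%:Z - 1) ->
    (forall S : {set 'I_n}, 'C(#|S|, 2)%:Z <= \sum_(i in S) R 0 i) ->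
    score_vector T <> R ->
  exists T', hankel_tournament T' /\
    \sum_a `|score_vector T' 0 a - R 0 a| < \sum_a `|score_vector T 0 a - R 0 a|.
Proof.
move=> Thankel Rmir Rlandau TR; have [Ttour _] := Thankel.
have [T01 _ _] := Ttour.
pose d a := score_vector T 0 a - R 0 a.
have d_odd a : d (rev_ord a) = - d a.
  by rewrite /d; have := Rmir a; have := hankel_score_mirror a Thankel; lia.
have [i di] : exists i, 0 < d i.
  apply/existsP; apply: contra_notT TR => /existsPn d_le0.
  apply/rowP => a; have := d_le0 a; have := d_le0 (rev_ord a).
  by rewrite d_odd /d; lia.
have [u /andP[iu u_good]|stuck] :=
    pickP [pred u | connect (exposed_arc T) i u & exposed T u ==> (d u < 0)].
  have /connectP[p0 ip0 u_last] := iu.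
  case/shortenP: ip0 u_last => p ip p_uniq _ u_last.
  have [T' [T'hankel T'score]] := reroute Thankel ip p_uniq.
  exists T'; split=> //.
  have i_expo : exposed T u -> exposed T i.
    rewrite u_last; case: p ip {p_uniq T'score u_last} => //= y p.
    by case/andP=> /andP[].
  have new_d a : score_vector T' 0 a - R 0 a = d a
      - ((a == i)%:R - (a == rev_ord i)%:R)
      + (exposed T u)%:R * ((a == u)%:R - (a == rev_ord u)%:R).
    by rewrite T'score -u_last /d; ring.
  under eq_bigr do rewrite new_d.
  apply: odd_transfer_decrease => // Tu; split; first by move: u_good; rewrite /= Tu.
  apply: contraTneq (i_expo Tu) => u_i'.
  by have := exposed_mirror Ttour Tu; rewrite u_i' rev_ordK.
pose S := [set u | connect (exposed_arc T) i u].
have S_stuck x : x \in S -> exposed T x /\ 0 <= d x.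
  rewrite inE => ix; have := stuck x; rewrite /= ix /=.
  by case: (exposed T x) => //= dx; rewrite leNgt dx.
have S_closed x y : x \in S -> y \notin S -> T x y = 0.
  move=> xS; have [x_expo _] := S_stuck x xS.
  case: (T01 x y) => // Txy; rewrite !inE in xS *; case/negP.
  apply: connect_trans xS (connect1 _).
  by rewrite /exposed_arc x_expo Txy eqxx.
have scoreS : \sum_(x in S) score_vector T 0 x = 'C(#|S|, 2)%:Z.
  rewrite -(sum_inner_arcs S Ttour); apply: eq_bigr => x xS.
  rewrite mxE [RHS]big_mkcond; apply: eq_bigr => y _.
  by case: ifPn => // /(S_closed x y xS).
have iS : i \in S by rewrite inE connect0.
have : 0 < \sum_(x in S) d x.
  rewrite (bigD1 i) //= ltr_wpDr // sumr_ge0 // => x /andP[xS _].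
  by case: (S_stuck x xS).
by rewrite sumrB scoreS subr_gt0 ltNge Rlandau.
Qed.

Theorem theorem11 (n : nat) (R : 'rV[int]_n)
    (R_ge0 : forall i : 'I_n, 0 <= R 0 i)
    (R_ndecr : forall i j : 'I_n, (i <= j)%N -> R 0 i <= R 0 j) :
  (exists T : 'M[int]_n, hankel_tournament T /\ score_vector T = R)
  <->
  (forall i : 'I_n, R 0 i + R 0 (rev_ord i) = n%:Z - 1)
  /\ (forall k : nat, (1 <= k <= n)%N ->
        'C(k, 2)%:Z <= \sum_(i < n | (i < k)%N) R 0 i
        /\ (k = n -> \sum_(i < n | (i < k)%N) R 0 i = 'C(k, 2)%:Z)).
Proof.
split=> [[T [Thankel <-]]|[Rmir Rprefix]].
  have [Ttour _] := Thankel; have [T01 _ _] := Ttour.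
  split=> [i|k /andP[_ le_kn]]; first exact: hankel_score_mirror.
  have inner := sum_inner_arcs [set i : 'I_n | (i < k)%N] Ttour.
  rewrite (card_prefix le_kn) in inner; rewrite -inner.
  have -> : \sum_(i < n | (i < k)%N) score_vector T 0 i
      = \sum_(i in [set i : 'I_n | (i < k)%N]) score_vector T 0 i.
    by apply: eq_bigl => i; rewrite inE.
  split=> [|kn].
    apply: ler_sum => i _; rewrite mxE [leLHS]big_mkcond.
    by apply: ler_sum => j _; case: ifP => _ //; case: (T01 i j) => ->.
  apply: eq_bigr => i _; rewrite mxE; apply: eq_bigl => j.
  by rewrite inE kn ltn_ord.
have Rlandau (S : {set 'I_n}) : 'C(#|S|, 2)%:Z <= \sum_(i in S) R 0 i.
  have [S0|S_gt0] := posnP #|S|; first by rewrite S0 (cards0_eq S0) big_set0.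
  apply: le_trans (prefix_sum_min S R_ndecr).
  have leSn : (#|S| <= n)%N by rewrite -[leqRHS]card_ord max_card.
  by have [] := Rprefix #|S|; rewrite ?S_gt0.
pose dev (T : 'M[int]_n) := \sum_a `|score_vector T 0 a - R 0 a|.
have dev_ge0 T : 0 <= dev T by apply: sumr_ge0.
have [m] := ubnP `|dev (\matrix_(i < n, j < n) ((i < j)%N : nat)%:Z)|%N.
have := transitive_hankel n.
elim: m (\matrix_(_, _) _) => // m IHm T Thankel devT.
have [TR|TR] := eqVneq (score_vector T) R; first by exists T.
have [T' [T'hankel T'lt]] := deviation_decrease Thankel Rmir Rlandau (elimN eqP TR).
apply: IHm T'hankel _.
have := dev_ge0 T; have := dev_ge0 T'; rewrite -/(dev _) -/(dev T) in T'lt.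
by lia.
Qed.
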